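(* Let $A$ be a prime Novikov algebra. Then every ideal $I$ of $A$, regarded as an algebra in its own right, is a prime Novikov algebra.
   Context: Algebras are (not necessarily associative, not necessarily unital) algebras over a field. Write $(a,b,c)=(ab)c-a(bc)$. A Novikov algebra is an algebra satisfying the identities $(a,b,c)=(b,a,c)$ and $(ab)c=(ac)b$. ''Ideal'' means two-sided ideal. For subspaces $U,V$, the product $UV$ is the linear span of all $uv$, $u\in U$, $v\in V$. An algebra $A$ is prime if for any ideals $I,J$ of $A$, $IJ=0$ implies $I=0$ or $J=0$. *)

(* Defs.v *)
From HB Require Import structures.
From mathcomp Require Import all_boot all_algebra sesquilinear.
From mathcomp Require Import boolp classical_sets.

Set Implicit Arguments.
Unset Strict Implicit.
Unset Printing Implicit Defensive.

Import GRing.Theory.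

Local Open Scope classical_set_scope.
Local Open Scope ring_scope.

(* An algebra over the field k is a vector space A : lmodType k, of arbitrary *)
(* dimension, together with a bilinear product mul : {bilinear A -> A -> A}.  *)
(* Neither associativity nor a unit is assumed.                               *)

Section Algebra.
Variables (k : fieldType) (A : lmodType k) (mul : {bilinear A -> A -> A}).

Definition associator (a b c : A) : A := mul (mul a b) c - mul a (mul b c).

Definition novikov : Prop :=
  (forall a b c : A, associator a b c = associator b a c) /\
  (forall a b c : A, mul (mul a b) c = mul (mul a c) b).

Definition is_subspace (U : set A) : Prop := submod_closed [in U].

Definition lin_span (S : set A) : set A := smallest is_subspace S.

Definition prod_space (U V : set A) : set A :=
  lin_span [set x | exists u v : A, [/\ U u, V v & x = mul u v]].

Record ideal := Ideal {
  ideal_set :> set A;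
  ideal_subspace : is_subspace ideal_set;
  ideal_mull : forall a x : A, ideal_set x -> ideal_set (mul a x);
  ideal_mulr : forall a x : A, ideal_set x -> ideal_set (mul x a)
}.

(* The zero algebra counts as prime. *)
Definition prime_alg : Prop :=
  forall I J : ideal, prod_space I J = [set 0] ->
    (I : set A) = [set 0] \/ (J : set A) = [set 0].

Definition prime_novikov : Prop := novikov /\ prime_alg.

End Algebra.

Section IdealAlgebra.
Variables (k : fieldType) (A : lmodType k) (mul : {bilinear A -> A -> A}).
Variable I : ideal mul.

(* The ideal I as a vector space, with the operations inherited from A. *)
Definition ideal_space : Type := {x : A | x \in ideal_set I}.

HB.instance Definition _ := SubChoice.on ideal_space.

Lemma ideal_subsemimod_closed : subsemimod_closed [in ideal_set I].
Proof. exact: GRing.submod_closed_semi (ideal_subspace I). Qed.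

HB.instance Definition _ := GRing.SubChoice_isSubLmodule.Build
  k A [in ideal_set I] ideal_space ideal_subsemimod_closed.

Lemma ideal_mul_closed (x y : ideal_space) : mul (val x) (val y) \in ideal_set I.
Proof. by apply/mem_set/ideal_mull/set_mem/(valP y). Qed.

Definition ideal_mul (x y : ideal_space) : ideal_space :=
  exist _ (mul (val x) (val y)) (ideal_mul_closed x y).

Lemma ideal_mul_bilinear : bilinear_for *:%R *:%R ideal_mul.
Proof.
split=> [y|x] a u v; apply: val_inj; rewrite [RHS]linearP.
- by rewrite -[LHS]/(mul (val (a *: u + v)) (val y)) linearP linearPl.
- by rewrite -[LHS]/(mul (val x) (val (a *: u + v))) [val (_ + _)]linearP linearPr.
Qed.

HB.instance Definition _ := bilinear_isBilinear.Build k
  ideal_space ideal_space ideal_space *:%R *:%R ideal_mul ideal_mul_bilinear.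

End IdealAlgebra.

Arguments ideal_mul {k A mul} I x y.

(* Main.v *)
Require Import Defs.
From mathcomp Require Import all_boot all_algebra sesquilinear.
From mathcomp Require Import boolp classical_sets.

(** The left annihilator of a nonzero ideal of a Novikov algebra A is an ideal,
    hence is 0 when A is prime.  Let I be a nonzero ideal of the prime algebra A.
    - If I S <= S, then lann S is an ideal of A: for x in lann S,
      ((a x) s) i = ((a i) x) s = 0 for all i in I, whence (a x) s = 0.
    - If N is stable under I on both sides and N N = 0, then N = 0.  Otherwise
      P = lann N is a nonzero ideal, and (a y) p = (a p) y = 0 for y in N and
      p in P gives A N = 0, from which A (N A) = 0 follows; so N lies in the
      ideal {t | A t = A (t A) = 0} of A, whose square is zero.
    - If K, L are ideals of I with K L = 0 and K <> 0, then K1 = lann L :&: I is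
      a nonzero ideal of A, and L K1 <= L :&: K1 has square zero, so L K1 = 0
      and L = 0. *)

Set Implicit Arguments.
Unset Strict Implicit.
Unset Printing Implicit Defensive.

Import GRing.Theory.
Local Open Scope classical_set_scope.
Local Open Scope ring_scope.

Section Subspaces.
Variables (k : fieldType) (A : lmodType k) (mul : {bilinear A -> A -> A}).

Lemma is_subspaceP (U : set A) :
  is_subspace U <-> U 0 /\ forall c u v, U u -> U v -> U (c *: u + v).
Proof.
split=> [[U0 UD]|[U0 UD]].
  split=> [|c u v Uu Uv]; first exact: set_mem U0.
  by apply: set_mem; apply: UD; apply: mem_set.
split=> [|c u v Uu Uv]; first exact: mem_set.
by apply: mem_set; apply: UD; apply: set_mem.
Qed.

Lemma prod_space_eq0 (U V : set A) :
  prod_space mul U V = [set 0] <-> forall u v, U u -> V v -> mul u v = 0.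
Proof.
split=> [UV0 u v Uu Vv|UV0].
  have : prod_space mul U V (mul u v).
    by apply: sub_gen_smallest; exists u, v; split.
  by rewrite UV0.
apply/seteqP; split=> [x|x ->].
  apply: smallest_sub => [|y [u [v [Uu Vv ->]]]]; last exact: UV0.
  apply/is_subspaceP; split=> // c u v -> ->.
  by rewrite /= scaler0 addr0.
by move=> W [/is_subspaceP[W0 _] _].
Qed.

Lemma prime_algP : prime_alg mul <-> forall I J : ideal mul,
  (forall u v, ideal_set I u -> ideal_set J v -> mul u v = 0) ->
  (forall u, ideal_set I u -> u = 0) \/ (forall v, ideal_set J v -> v = 0).
Proof.
have eq0 (I : ideal mul) : (I : set A) = [set 0] <-> forall u, ideal_set I u -> u = 0.
  split=> [-> //|I0]; apply/seteqP; split=> [|_ ->]; first exact: I0.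
  by case/is_subspaceP: (ideal_subspace I).
split=> prA I J.
  by move=> /prod_space_eq0/prA[] /eq0; [left|right].
by move=> /prod_space_eq0/prA[] /eq0; [left|right].
Qed.

End Subspaces.

Section NovikovAlgebra.
Variables (k : fieldType) (A : lmodType k) (mul : {bilinear A -> A -> A}).
Hypothesis mul_novikov : novikov mul.

Local Notation "x * y" := (mul x y) : ring_scope.

Lemma novikov_mulAC a b c : (a * b) * c = (a * c) * b.
Proof. exact: mul_novikov.2. Qed.

Lemma novikov_mulCA a b c : (a * b) * c = a * (b * c) + (b * a) * c - b * (a * c).
Proof.
have /eqP := mul_novikov.1 a b c; rewrite /associator subr_eq => /eqP ->.
by rewrite addrC addrA.
Qed.

Definition lann (S : set A) : set A := [set x | forall s, S s -> x * s = 0].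

Lemma lann_subspace (S : set A) : is_subspace (lann S).
Proof.
apply/is_subspaceP; split=> [s _|c u v u0 v0 s Ss]; first by rewrite linear0l.
by rewrite linearPl u0 // v0 // scaler0 addr0.
Qed.

Lemma lann_mulr (S : set A) a x : lann S x -> lann S (x * a).
Proof. by move=> x0 s Ss; rewrite novikov_mulAC x0 ?linear0l. Qed.

(** Left symmetry reduces [(a * x) * s] to [a * (x * s)], [(x * a) * s] and [x * (a * s)], and each
    of them vanishes. *)
Lemma lann_mull (S : set A) a x :
  (forall s, S s -> S (a * s)) -> lann S x -> lann S (a * x).
Proof.
move=> aS x0 s Ss.
by rewrite novikov_mulCA (lann_mulr _ x0) // !x0 ?linear0r ?subr0 ?addr0 //; apply: aS.
Qed.

Definition lann_ideal (S : set A)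
    (Sl : forall a x, lann S x -> lann S (a * x)) : ideal mul :=
  Ideal (lann_subspace S) Sl (@lann_mulr S).

Section Prime.
Hypothesis mul_prime : prime_alg mul.

Lemma lann_ideal_eq0 (I : ideal mul) i0 x :
  ideal_set I i0 -> i0 <> 0 -> lann I x -> x = 0.
Proof.
move=> Ii0 i0N0 x0.
have Il a y : lann I y -> lann I (a * y).
  by apply: lann_mull => s; apply: ideal_mull.
have [|/(_ x x0) //|/(_ _ Ii0) //] := (prime_algP mul).1 mul_prime (lann_ideal Il) I.
by move=> u v /(_ v).
Qed.

Section NonzeroIdeal.
Variables (I : ideal mul) (i0 : A).
Hypotheses (Ii0 : ideal_set I i0) (i0N0 : i0 <> 0).

Lemma lann_mull_stable (S : set A) a x :
  (forall i s, ideal_set I i -> S s -> S (i * s)) -> lann S x -> lann S (a * x).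
Proof.
move=> IS x0 s Ss; apply: (lann_ideal_eq0 Ii0 i0N0) => i Ii.
(* Since [a * i] lies in [I], [lann_mull] applies with [a * i] in place of [a]. *)
rewrite novikov_mulAC (novikov_mulAC a x i); apply: lann_mull x0 s Ss => s.
exact/IS/ideal_mull.
Qed.

Lemma square_zero_stable_eq0 (N : set A) :
  (forall i y, ideal_set I i -> N y -> N (i * y)) ->
  (forall i y, ideal_set I i -> N y -> N (y * i)) ->
  (forall y z, N y -> N z -> y * z = 0) ->
  forall y, N y -> y = 0.
Proof.
move=> IN NI NN y Ny; apply: contrapT => yN0.
pose P := lann_ideal (fun a x => @lann_mull_stable N a x IN).
have Py : ideal_set P y by move=> z; apply: NN.
have AN a z : N z -> a * z = 0.
  move=> Nz; apply: (lann_ideal_eq0 Py yN0) => p Pp.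
  by rewrite novikov_mulAC; apply: (ideal_mull (i := P) a Pp).
(* By left symmetry the two sides differ by [(a * z) * i - a * (z * i)], which is 0 because A N =
   0. *)
have NA z a i : N z -> ideal_set I i -> (z * a) * i = z * (a * i).
  move=> Nz Ii; rewrite novikov_mulCA (AN a z Nz) (AN a (z * i)) ?linear0l ?subr0 ?addr0 //.
  exact: NI.
have INA j z b : ideal_set I j -> N z -> j * (z * b) = 0.
  move=> Ij Nz; apply: (lann_ideal_eq0 Ii0 i0N0) => i Ii.
  (* The term [j * (z * (b * i))] is 0 since [z * (b * i)] is in [N]. The other two,
     [((z * b) * j) * i] and [(z * b) * (j * i)], both equal [(z * (j * i)) * b] and cancel. *)
  rewrite novikov_mulCA NA // AN ?add0r; last exact/NI/Nz/ideal_mull.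
  rewrite (novikov_mulAC z b j) (novikov_mulAC _ b i) (novikov_mulAC z b).
  by rewrite (NA z j i) // subrr.
have ANA a z b : N z -> a * (z * b) = 0.
  move=> Nz; apply: (lann_ideal_eq0 Ii0 i0N0) => i Ii.
  by rewrite novikov_mulAC INA //; apply: ideal_mull.
(* The condition on [t * b] makes [Z] stable on the right: for [t] in [Z], left symmetry gives
   [(t * a) * c = t * (a * c)]. *)
pose Z := [set t | forall a, a * t = 0 /\ forall b, a * (t * b) = 0].
have Zsub : is_subspace Z.
  apply/is_subspaceP; split=> [a|c u v Zu Zv a].
    by split=> [|b]; rewrite ?linear0l linear0r.
  have [au aub] := Zu a; have [av avb] := Zv a; split=> [|b].
    by rewrite linearPr au av scaler0 addr0.
  by rewrite linearPl linearPr aub avb scaler0 addr0.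
have Zl a t : Z t -> Z (a * t).
  by move=> Zt; rewrite (Zt a).1 => b; split=> [|c]; rewrite ?linear0l ?linear0r.
have Zr a t : Z t -> Z (t * a).
  move=> Zt b; split=> [|c]; first exact: (Zt b).2.
  rewrite novikov_mulCA (Zt a).1 (Zt a).2 linear0l subr0 addr0.
  exact: (Zt b).2.
pose ZI := Ideal Zsub Zl Zr.
have Zy : ideal_set ZI y by move=> a; split=> [|b]; [apply: AN|apply: ANA].
(* As A Z = 0, [y] annihilates the ideal [Z], which contains [y <> 0]. *)
apply: (yN0); apply: (lann_ideal_eq0 Zy yN0) => t Zt.
exact: (Zt y).1.
Qed.

End NonzeroIdeal.

(** Primeness of [I] stated inside [A]: [K] and [L] stand for the images in [A] of two ideals of the
    algebra [I]. *)
Lemma annihilating_subideals (I : ideal mul) (K L : set A) :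
  K `<=` I ->
  (forall i x, ideal_set I i -> L x -> L (i * x)) ->
  (forall i x, ideal_set I i -> L x -> L (x * i)) ->
  (forall x y, K x -> L y -> x * y = 0) ->
  (forall x, K x -> x = 0) \/ (forall y, L y -> y = 0).
Proof.
move=> KI IL LI KL; have [K0|] := pselect (forall x, K x -> x = 0); first by left.
move=> /existsNP[x /not_implyP[Kx xN0]]; right=> y Ly.
have Ix := KI x Kx.
have annLl a z : lann L z -> lann L (a * z).
  exact: (lann_mull_stable Ix xN0).
have K1sub : is_subspace (lann L `&` I).
  have /is_subspaceP[L0 LD] := lann_subspace L.
  have /is_subspaceP[I0 ID] := ideal_subspace I.
  by apply/is_subspaceP; split=> // c u v [? ?] [? ?]; split; [apply: LD|apply: ID].
have K1l a z : (lann L `&` I) z -> (lann L `&` I) (a * z).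
  by move=> [? ?]; split; [apply: annLl|apply: ideal_mull].
have K1r a z : (lann L `&` I) z -> (lann L `&` I) (z * a).
  by move=> [? ?]; split; [apply: lann_mulr|apply: ideal_mulr].
pose K1 := Ideal K1sub K1l K1r.
have K1x : ideal_set K1 x by split=> // z; apply: KL.
(* The product [y * z] is in [L] because [z] is in [I], and in [lann L] because [z] is; [L] meets
   [lann L] in a set of square zero. *)
apply: (lann_ideal_eq0 K1x xN0) => z [annz Iz].
apply: (@square_zero_stable_eq0 I x Ix xN0 (L `&` lann L)).
- by move=> i u Ii [? ?]; split; [apply: IL|apply: annLl].
- by move=> i u Ii [? ?]; split; [apply: LI|apply: lann_mulr].
- by move=> u v [_ Lu] [Lv _]; apply: Lu.
- by split; [apply: LI|apply: annLl].
Qed.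

End Prime.
End NovikovAlgebra.

Lemma ideal_mul_novikov (k : fieldType) (A : lmodType k)
    (mul : {bilinear A -> A -> A}) (I : ideal mul) :
  novikov mul -> novikov (ideal_mul I).
Proof.
move=> [mulLS mulAC]; split=> a b c; apply: val_inj; last exact: mulAC.
by rewrite /associator !raddfB /=; apply: mulLS.
Qed.

Theorem theorem3 (k : fieldType) (A : lmodType k) (mul : {bilinear A -> A -> A}) :
  prime_novikov mul -> forall I : ideal mul, prime_novikov (ideal_mul I).
Proof.
move=> [nov prA] I; split; first exact: ideal_mul_novikov.
apply/prime_algP => K L KL.
have IP (x : ideal_space I) : ideal_set I (val x) := set_mem (valP x).
have toI x (Ix : ideal_set I x) : {x' : ideal_space I | val x' = x}.
  by exists (exist _ x (mem_set Ix)).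
have [||||K0|L0] := @annihilating_subideals k A mul nov prA I
    [set val x | x in (K : set _)] [set val x | x in (L : set _)].
- by move=> _ [x _ <-].
- move=> i _ /toI[i' <-] [x Lx <-].
  by exists (ideal_mul I i' x) => //; apply: ideal_mull.
- move=> i _ /toI[i' <-] [x Lx <-].
  by exists (ideal_mul I x i') => //; apply: ideal_mulr.
- by move=> _ _ [x Kx <-] [y Ly <-]; have /(congr1 val) := KL x y Kx Ly.
- by left=> x Kx; apply: val_inj; apply: K0; exists x.
- by right=> x Lx; apply: val_inj; apply: L0; exists x.
Qed.
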